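(* Let $A$ and $B$ be nontrivial commutative torsion groups such that $\exp(A[p^\infty])$ is finite for every prime $p$. (a) $\delta^\circ(A,B)=\sup_{p}\delta^\circ(A[p^\infty],B[p^\infty])$, the supremum over all primes $p$. (b) If there are infinitely many primes $p$ such that $A[p^\infty]$ and $B[p^\infty]$ are both nonzero, then $\delta^\circ(A,B)=\infty$. (c) If there is a prime $p$ with $A[p^\infty]\neq 0$ and $B[p^\infty]$ of infinite exponent, then $\delta^\circ(A,B)=\infty$. (d) If there is a prime $p$ with $A[p^\infty]$ infinite and $B[p^\infty]\ne 0$, then $\delta^\circ(A,B)=\infty$. (e) Otherwise, i.e. if the set $P$ of primes $p$ for which $A[p^\infty]$ and $B[p^\infty]$ are both nonzero is finite, and for each $p\in P$ the group $A[p^\infty]$ is finite and $B[p^\infty]$ has finite exponent, then $\delta^\circ(A,B)$ is finite; explicitly, writing for $p\in P$ $A[p^\infty]\cong\bigoplus_{i=1}^{r_p}\mathbb{Z}/p^{\alpha_{p,i}}\mathbb{Z}$ with $\alpha_{p,1}\ge\dots\ge\alpha_{p,r_p}\ge1$ and $\exp(B[p^\infty])=p^{\beta_p}$, we have $\delta^\circ(A,B)=\max\big(\{0\}\cup\{\sum_{i=1}^{r_p}(p^{\alpha_{p,i}}-1)+(\beta_p-1)(p-1)p^{\alpha_{p,1}-1}: p\in P\}\big)$.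
   Context: For commutative groups $A,B$, $B^A$ denotes the commutative group (under pointwise addition) of all maps $A\to B$. For $a\in A$, the difference operator $\Delta_a:B^A\to B^A$ is $(\Delta_a f)(x)=f(x+a)-f(x)$. Let $\widetilde{\mathbb N}=\mathbb N\cup\{-\infty,\infty\}$ ($\mathbb N=\{0,1,2,\dots\}$), totally ordered with $-\infty$ least and $\infty$ greatest. The functional degree $\operatorname{fdeg}(f)\in\widetilde{\mathbb N}$ of $f\in B^A$ is: $-\infty$ if $f=0$; otherwise the least $n\in\mathbb N$ such that $\Delta_{a_1}\cdots\Delta_{a_{n+1}}f=0$ for all $a_1,\dots,a_{n+1}\in A$; and $\infty$ if no such $n$ exists. Define $\delta^\circ(A,B)=\sup\{\operatorname{fdeg}(f): f\in B^A,\ \operatorname{fdeg}(f)<\infty\}$ (supremum in $\widetilde{\mathbb N}$). For a prime $p$, $A[p^\infty]=\{x\in A: p^kx=0\text{ for some }k\ge1\}$. The exponent $\exp(G)$ of a group is the least $n\ge1$ with $nG=0$, or $\infty$ if none exists. *)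

(* Defs.v *)
From HB Require Import structures.
From mathcomp Require Import all_boot all_order all_algebra.
From mathcomp Require Import boolp.
From Stdlib Require Import ClassicalEpsilon.
Set Implicit Arguments. Unset Strict Implicit. Unset Printing Implicit Defensive.
Import Order.TTheory GRing.Theory Num.Theory.
Local Open Scope ring_scope.

Inductive enat := ENegInf | EFin of nat | EPosInf.

Definition ele (x y : enat) : Prop :=
  match x, y with
  | ENegInf, _ => True
  | _, EPosInf => True
  | EFin m, EFin n => (m <= n)%N
  | _, _ => False
  end.

Definition is_esup (S : enat -> Prop) (s : enat) : Prop :=
  (forall y, S y -> ele y s) /\ (forall z, (forall y, S y -> ele y z) -> ele s z).

(* The supremum in the complete lattice enat (exists and is unique). *)
Definition esup (S : enat -> Prop) : enat :=
  epsilon (inhabits ENegInf) (is_esup S).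

Section FunctionalDegree.
Variables (A B : zmodType).

Definition Delta (a : A) (f : A -> B) : A -> B := fun x => f (x + a) - f x.

Definition diffs (l : seq A) (f : A -> B) : A -> B := foldr Delta f l.

Definition vanishes (f : A -> B) (n : nat) : Prop :=
  forall l : seq A, size l = n.+1 -> forall x, diffs l f x = 0.

Definition fdeg_spec (f : A -> B) (d : enat) : Prop :=
  match d with
  | ENegInf => forall x, f x = 0
  | EFin n => (exists x, f x <> 0) /\ vanishes f n /\
              (forall m, vanishes f m -> (n <= m)%N)
  | EPosInf => (exists x, f x <> 0) /\ forall n, ~ vanishes f n
  end.

Definition fdeg (f : A -> B) : enat := epsilon (inhabits EPosInf) (fdeg_spec f).

Definition delta0 : enat :=
  esup (fun d => exists f : A -> B, d = fdeg f /\ d <> EPosInf).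

End FunctionalDegree.

Section Primary.
Variables (A : zmodType) (p : nat).

Definition ptors : {pred A} :=
  fun x => `[< exists k, (0 < k)%N /\ x *+ (p ^ k) = 0 >].

Lemma ptors_zmod_closed : zmod_closed ptors.
Proof.
split.
  by apply/asboolP; exists 1%N; split => //; rewrite mul0rn.
move=> x y /asboolP [k [k0 hk]] /asboolP [l [l0 hl]]; apply/asboolP.
exists (k + l)%N; split; first by rewrite addn_gt0 k0.
rewrite mulrnBl expnD.
have -> : x *+ (p ^ k * p ^ l) = 0 by rewrite mulrnA hk mul0rn.
have -> : y *+ (p ^ k * p ^ l) = 0 by rewrite mulnC mulrnA hl mul0rn.
by rewrite subr0.
Qed.

HB.instance Definition _ := GRing.isZmodClosed.Build A ptors ptors_zmod_closed.

Definition Ptors := {x : A | x \in ptors}.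
HB.instance Definition _ := SubType.copy Ptors {x : A | x \in ptors}.
HB.instance Definition _ := Choice.copy Ptors {x : A | x \in ptors}.
HB.instance Definition _ := [SubChoice_isSubZmodule of Ptors by <:].

End Primary.

Definition nonzero_group (G : zmodType) : Prop := exists x : G, x <> 0.
Definition torsion_group (G : zmodType) : Prop :=
  forall x : G, exists n, (0 < n)%N /\ x *+ n = 0.
Definition is_exponent (G : zmodType) (n : nat) : Prop :=
  [/\ (0 < n)%N, (forall x : G, x *+ n = 0) &
      forall m, (0 < m)%N -> (forall x : G, x *+ m = 0) -> (n <= m)%N].
Definition finite_exponent (G : zmodType) : Prop := exists n, is_exponent G n.
Definition finite_group (G : zmodType) : Prop := exists s : seq G, forall x, x \in s.

(* G ≅ ⊕_{i < size a} Z/p^{a_i}Z : there are g_0,...,g_{r-1} in G such that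
   c |-> \sum_i c_i g_i is a surjective homomorphism Z^r -> G whose kernel is
   exactly { c | p^{a_i} divides c_i for all i }. *)
Definition cyclic_decomposition (G : zmodType) (p : nat) (a : seq nat) : Prop :=
  exists g : nat -> G,
    (forall x : G, exists c : nat -> int, x = \sum_(i < size a) g i *~ c i) /\
    (forall c : nat -> int, \sum_(i < size a) g i *~ c i = 0 <->
        forall i, (i < size a)%N -> ((p ^ nth 0%N a i)%:Z %| c i)%Z).

(* Main.v *)
(** The operators [D = Delta a] generate the augmentation ideal of the group ring acting on
    functions. A function of finite degree into a [p]-primary group is invariant under
    translation by elements of order prime to [p], which reduces everything to primary
    components. For a [p]-group with cyclic generators of orders [q_i = p^(a_i)], give [p]
    the weight [w = (p - 1) p^(max a_i - 1)] and each [D_i] the weight one: the relations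
    [(1 + D_i)^q_i = 1] rewrite [D_i^q_i] without decreasing weights, so modulo [p^beta]
    every monomial of weight greater than [sum (q_i - 1) + (beta - 1) w] vanishes. Keeping
    track of the terms of minimal weight shows that a monomial of this weight does not kill
    the indicator function of [0]. When a primary component of [A] may be infinite, the
    same computation is applied to a finite elementary abelian quotient [A / M], with [M]
    obtained from Zorn's lemma. *)

Require Import Defs.
From HB Require Import structures.
From mathcomp Require Import all_boot all_order all_algebra.
From mathcomp Require Import boolp classical_sets.
From mathcomp Require Import zify.
Set Implicit Arguments. Unset Strict Implicit. Unset Printing Implicit Defensive.
Import GRing.Theory.
Local Open Scope ring_scope.

(** * Extended naturals and the functional degree *)

Lemma ele_refl x : ele x x.
Proof. by case: x => //= n. Qed.

Lemma ele_trans y x z : ele x y -> ele y z -> ele x z.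
Proof. by case: x y z => [|m|] [|n|] [|k|] //=; apply: leq_trans. Qed.

Lemma ele_anti x y : ele x y -> ele y x -> x = y.
Proof.
by case: x y => [|m|] [|n|] //= le_mn le_nm; congr EFin; apply/eqP; rewrite eqn_leq le_mn.
Qed.

Lemma ele_fin_infty x : (forall n, ~ ele x (EFin n)) -> x = EPosInf.
Proof.
case: x => [|m|] // h; first by case: (h 0).
by case: (h m); rewrite /= leqnn.
Qed.

Lemma least_nat (Q : nat -> Prop) :
  (exists n, Q n) -> exists n, Q n /\ forall m, Q m -> (n <= m)%N.
Proof.
move=> [n Qn]; have ex : exists k, `[< Q k >] by exists n; apply/asboolP.
by case: (ex_minnP ex) => k /asboolP Qk mink; exists k; split=> // m /asboolP/mink.
Qed.

Lemma esup_exists (S : enat -> Prop) : exists s, is_esup S s.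
Proof.
case: (pselect (exists n, forall y, S y -> ele y (EFin n))) => [/least_nat[n [ubn minn]]|noub].
  case: (pselect (forall y, S y -> ele y ENegInf)) => [ubN|nubN].
    by exists ENegInf; split.
  exists (EFin n); split=> // z ubz; case: z ubz => [//|m|//]; exact: minn.
exists EPosInf; split; first by case.
case=> [|m|//] ubz; exfalso; apply: noub.
  by exists 0%N => y /ubz; case: y.
by exists m.
Qed.

Lemma esupP S : is_esup S (esup S).
Proof. exact: ClassicalEpsilon.epsilon_spec (esup_exists S). Qed.

Lemma esup_le S z : ele (esup S) z <-> forall y, S y -> ele y z.
Proof.
have [ub least] := esupP S; split=> [le_z y Sy|/least //].
exact: ele_trans (ub _ Sy) le_z.
Qed.

Lemma diffs_cat (A B : zmodType) (s t : seq A) (f : A -> B) :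
  diffs (s ++ t) f = diffs s (diffs t f).
Proof. by rewrite /diffs foldr_cat. Qed.

Lemma diffs_zero (A B : zmodType) (s : seq A) (f : A -> B) :
  (forall x, f x = 0) -> forall x, diffs s f x = 0.
Proof. by move=> f0; elim: s => //= a s IH x; rewrite /Delta !IH subrr. Qed.

Lemma Delta_comm (A B : zmodType) (a b : A) (f : A -> B) :
  Delta a (Delta b f) = Delta b (Delta a f).
Proof.
apply: funext => x; rewrite /Delta (addrAC x a b) !opprB.
by rewrite addrACA [RHS]addrACA; congr (_ + _); rewrite addrC.
Qed.

Lemma diffs_Delta (A B : zmodType) (a : A) (s : seq A) (f : A -> B) :
  diffs s (Delta a f) = Delta a (diffs s f).
Proof. by elim: s => //= b s ->; rewrite Delta_comm. Qed.

Lemma diffs_comm (A B : zmodType) (s t : seq A) (f : A -> B) :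
  diffs s (diffs t f) = diffs t (diffs s f).
Proof. by elim: t => //= a t <-; rewrite diffs_Delta. Qed.

Lemma perm_diffs (A B : zmodType) (s t : seq A) (f : A -> B) :
  perm_eq s t -> diffs s f = diffs t f.
Proof.
elim: s t => [|a s IH] t; first by move/perm_size/esym/size0nil ->.
move=> perm_st; have /path.splitPr st: a \in t.
  by rewrite -(perm_mem perm_st) mem_head.
case: st perm_st => t1 t2; rewrite perm_sym -cat1s perm_catCA /= perm_cons perm_sym.
move=> /IH ->; rewrite !diffs_cat /=; exact: (esym (diffs_Delta _ _ _)).
Qed.

Lemma diffs_nseqS (A B : zmodType) (a : A) n (f : A -> B) :
  diffs (nseq n.+1 a) f = diffs (nseq n a) (Delta a f).
Proof. by rewrite diffs_Delta. Qed.

Lemma diffs_mulrn (A B : zmodType) (s : seq A) (f : A -> B) n x :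
  diffs s (fun y => f y *+ n) x = diffs s f x *+ n.
Proof. by elim: s x => //= a s IH x; rewrite /Delta !IH mulrnBl. Qed.

Lemma diffs_invariant (A B : zmodType) (s : seq A) (f : A -> B) a :
  (forall x, f (x + a) = f x) -> forall x, diffs s f (x + a) = diffs s f x.
Proof. by move=> fa; elim: s => //= b s IH x; rewrite /Delta addrAC !IH. Qed.

Lemma diffs_torsion (A B : zmodType) (s : seq A) (f : A -> B) n :
  (forall x, f x *+ n = 0) -> forall x, diffs s f x *+ n = 0.
Proof. by move=> fn x; rewrite -diffs_mulrn diffs_zero. Qed.

Lemma vanishes_monotone (A B : zmodType) (f : A -> B) m n :
  (m <= n)%N -> vanishes f m -> vanishes f n.
Proof.
move=> le_mn vm s ss x; rewrite -(cat_take_drop (n - m) s) diffs_cat.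
by apply: diffs_zero => y; apply: vm; rewrite size_drop ss; lia.
Qed.

Lemma fdegP (A B : zmodType) (f : A -> B) : fdeg_spec f (fdeg f).
Proof.
apply: ClassicalEpsilon.epsilon_spec.
case: (pselect (forall x, f x = 0)) => [f0|/existsNP nf0]; first by exists ENegInf.
case: (pselect (exists n, vanishes f n)) => [/least_nat[n [vn minn]]|/forallNP nv].
  by exists (EFin n).
by exists EPosInf.
Qed.

Lemma fdeg_le (A B : zmodType) (f : A -> B) n :
  ele (fdeg f) (EFin n) <-> vanishes f n.
Proof.
have := fdegP f; case: (fdeg f) => [f0|k [_ [vk mink]]|[_ nv]] /=; split=> //.
- by move=> _ s _; apply: diffs_zero.
- by move=> le_kn; apply: vanishes_monotone vk.
- exact: mink.
- exact: nv.
Qed.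

Lemma fdeg_finite (A B : zmodType) (f : A -> B) :
  fdeg f <> EPosInf <-> exists n, vanishes f n.
Proof.
split=> [fin|[n]]; last by move/fdeg_le; case: (fdeg f).
case E : (fdeg f) fin => [|n|//] _; last by exists n; apply/fdeg_le; rewrite E; apply: ele_refl.
by exists 0%N; apply/fdeg_le; rewrite E.
Qed.

(** Finite bounds on the supremum are treated through [vanishes] alone; the bound [ENegInf] is left
    to the next lemma. *)
Lemma delta0_le (A B : zmodType) n :
  ele (delta0 A B) (EFin n) <->
  forall f : A -> B, (exists m, vanishes f m) -> vanishes f n.
Proof.
rewrite /delta0 esup_le; split=> [h f fin|h d [f [-> fin]]].
  by apply/fdeg_le/h; exists f; split=> //; apply/fdeg_finite.
by apply/fdeg_le/h/fdeg_finite.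
Qed.

(** A nonzero constant function has degree zero. *)
Lemma delta0_NegInf (A B : zmodType) :
  nonzero_group B -> ~ ele (delta0 A B) ENegInf.
Proof.
move=> [b b0] /esup_le h; have: ele (fdeg (fun _ : A => b)) ENegInf.
  apply: h; eexists; split=> //; apply/fdeg_finite; exists 0%N.
  by case=> [|a[]] //= _ x; rewrite /Delta subrr.
by have := fdegP (fun _ : A => b); case: (fdeg _) => //= /(_ 0).
Qed.

(** * Binomial expansion of translations *)

(** Translation by [a] is [1 + D] with [D = Delta a]; its [n]-th power expands by Pascal's rule. *)
Lemma translate_binomial (A B : zmodType) (a : A) n (f : A -> B) x :
  f (x + a *+ n) = \sum_(k < n.+1) diffs (nseq k a) f x *+ 'C(n, k).
Proof.
elim: n f => [|n IH] f; first by rewrite big_ord1 mulr0n addr0.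
have -> : f (x + a *+ n.+1) = f (x + a *+ n) + Delta a f (x + a *+ n).
  by rewrite /Delta [RHS]addrC subrK mulrSr addrA.
rewrite !IH [RHS]big_ord_recl /= bin0.
under [in RHS]eq_bigr => i _ do
  rewrite /bump leq0n add1n binS mulrnDr.
rewrite big_split /= addrA; congr (_ + _); last first.
  by apply: eq_bigr => i _; rewrite -diffs_nseqS.
rewrite big_ord_recl /= bin0; congr (_ + _).
by rewrite [RHS]big_ord_recr /= bin_small // mulr0n addr0.
Qed.

(* The relation [(1 + D)^n = 1] for the translation by an element of order [n], solved for [D^n]. *)
Lemma diffs_nseq_periodic (A B : zmodType) (a : A) n (f : A -> B) x :
  f (x + a *+ n.+1) = f x ->
  diffs (nseq n.+1 a) f x =
    - \sum_(k < n) diffs (nseq k.+1 a) f x *+ 'C(n.+1, k.+1).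
Proof.
rewrite translate_binomial big_ord_recl /= bin0 mulr1n => /eqP.
rewrite -subr_eq0 addrAC subrr add0r big_ord_recr /= addrC addr_eq0 => /eqP.
by rewrite /bump !add1n binn mulr1n => ->.
Qed.

(** Take [j = a - v] with [v] the [p]-adic valuation of [k], and use
    [k C(p^a, k) = p^a C(p^a - 1, k - 1)]. *)
Lemma logn_bin_pfactor p a k : prime p -> (0 < k < p ^ a)%N ->
  exists j, [/\ (0 < j)%N, (j <= a)%N, (p ^ j %| 'C(p ^ a, k))%N & (p ^ (a - j) <= k)%N].
Proof.
move=> p_pr /andP[k_gt0 lt_k]; exists (a - logn p k)%N.
have v_lt : (logn p k < a)%N.
  rewrite ltnNge; apply/negP => le_a; move: lt_k; apply/negP; rewrite -leqNgt.
  by apply: dvdn_leq => //; rewrite pfactor_dvdn.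
split; [lia | lia | | by rewrite subKn ?(ltnW v_lt) // dvdn_leq // pfactor_dvdnn].
have C_gt0 : (0 < 'C(p ^ a, k))%N by rewrite bin_gt0 ltnW.
rewrite pfactor_dvdn // leq_subLR -lognM //.
case: k k_gt0 lt_k v_lt C_gt0 => // k _ lt_k _ C_gt0.
rewrite -mul_bin_diag -pfactor_dvdn // ?dvdn_mulr //.
by rewrite mul_bin_diag muln_gt0.
Qed.

(** Rewriting [D^(p^a)] gives terms [C(p^a, k) D^k] of weight at least [p^a]; equality is possible
    only at [k = p^(a-1)], the term that decides the lower bound. *)
Lemma bin_pfactor_weight p a m k : prime p -> (0 < a <= m)%N -> (0 < k < p ^ a)%N ->
  exists j, (p ^ j %| 'C(p ^ a, k))%N /\
    (p ^ a + (k != p ^ a.-1) <= j * ((p - 1) * p ^ m.-1) + k)%N.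
Proof.
move=> p_pr /andP[a_gt0 le_am] k_bd; have p_gt1 := prime_gt1 p_pr.
have [j [j_gt0 le_ja dvd_j le_k]] := logn_bin_pfactor p_pr k_bd.
exists j; split=> //; have /andP[k_gt0 lt_k] := k_bd.
have le_w : (p ^ a.-1 <= p ^ m.-1)%N by rewrite leq_pexp2l //; lia.
have Epa : (p ^ a = p * p ^ a.-1)%N by rewrite -expnS prednK.
case: j j_gt0 le_ja dvd_j le_k => [//|[|j]] _ le_ja _ le_k.
  (* For [j = 1]: [k >= p^(a-1)], and [p] weighs at least [(p - 1) p^(a-1)]. *)
  rewrite subn1 in le_k; have := leq_mul (leqnn (p - 1)) le_w.
  rewrite Epa; move: le_k le_w; move: (p ^ a.-1)%N (p ^ m.-1)%N => u w.
  by case: eqP => [->|]; nia.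
(* For [j >= 2]: twice the weight of [p] is already at least [p^a], and [k > 0] makes the inequality
   strict. *)
have : (2 * ((p - 1) * p ^ a.-1) <= j.+2 * ((p - 1) * p ^ m.-1))%N.
  by rewrite !leq_mul.
rewrite Epa; case: (k != _); move: (p ^ a.-1)%N (_ * (_ * _ ^ m.-1))%N => u w; nia.
Qed.

(** As [p] divides [C(p^a, k + 1)], Pascal's rule makes consecutive binomial coefficients of
    [p^a - 1] opposite modulo [p], starting from one. *)
Lemma coprime_bin_pfactor_pred p a k : prime p -> (k < p ^ a)%N ->
  coprime p 'C((p ^ a).-1, k).
Proof.
move=> p_pr; elim: k => [|k IH] lt_k; first by rewrite bin0 coprimen1.
have [j [j_gt0 _ dvd_j _]] := logn_bin_pfactor p_pr (lt_k : (0 < k.+1 < _)%N).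
have pC : (p %| 'C(p ^ a, k.+1))%N.
  by apply: dvdn_trans dvd_j; rewrite dvdn_exp.
move: pC; rewrite -[(p ^ a)%N in X in X -> _]prednK; last by rewrite expn_gt0 prime_gt0.
rewrite binS; have := IH (ltnW lt_k); rewrite !prime_coprime // => nC dvdC.
by apply: contra nC => dvdC1; rewrite -(dvdn_addr _ dvdC1).
Qed.

Lemma mulrn_dvd_eq0 (B : zmodType) (b : B) m n :
  (m %| n)%N -> b *+ m = 0 -> b *+ n = 0.
Proof. by move=> /dvdnP[q ->] bm; rewrite mulnC mulrnA bm mul0rn. Qed.

Lemma mulrn_gcd_eq0 (B : zmodType) (b : B) m n :
  b *+ m = 0 -> b *+ n = 0 -> b *+ gcdn m n = 0.
Proof.
case: m => [|m] bm bn; first by rewrite gcd0n.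
case: (egcdnP n (ltn0Sn m)) => u v E _.
have /eqP : b *+ (v * n + gcdn m.+1 n) = 0.
  by rewrite -E mulnC mulrnA bm mul0rn.
by rewrite mulrnDr (mulnC v) mulrnA bn mul0rn add0r => /eqP.
Qed.

Lemma mulrn_coprime_eq0 (B : zmodType) (b : B) m n : coprime m n ->
  b *+ m = 0 -> b *+ n = 0 -> b = 0.
Proof. by move=> /eqP E bm bn; have := mulrn_gcd_eq0 bm bn; rewrite E. Qed.

(** * Upper bound *)

Lemma size_count_sum (I : finType) (s : seq I) :
  size s = (\sum_(i : I) count_mem i s)%N.
Proof.
elim: s => [|i s IH] /=; first by rewrite big1.
rewrite big_split /= -IH (bigD1 i) //= eqxx big1 ?addn0 // => j.
by rewrite eq_sym => /negbTE ->.
Qed.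

Lemma perm_count_nseq (T : eqType) (x : T) n (s : seq T) : (n <= count_mem x s)%N ->
  exists t, perm_eq s (nseq n x ++ t).
Proof.
move=> le_n; exists (nseq (count_mem x s - n) x ++ filter (predC1 x) s).
rewrite catA -nseqD subnKC // -(perm_filterC (pred1 x) s) perm_cat2r.
rewrite -size_filter.
by have /all_pred1P <- : all (pred1 x) (filter (pred1 x) s) by exact: filter_all.
Qed.

(* Give [p] weight [w = (p - 1) p^(m - 1)] and each difference weight one: rewriting
   [D^q], for [q] the order, by [diffs_nseq_periodic] never decreases weights, and monomials
   that cannot be rewritten and exceed the bound are divisible by [p^beta]. *)
Lemma diffs_weight (A B : zmodType) (I : finType) (g : I -> A) (a : I -> nat)
    (p m beta : nat) (f : A -> B) :
  prime p -> (forall i, (0 < a i <= m)%N) ->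
  (forall i x, f (x + g i *+ (p ^ a i)) = f x) ->
  (forall x, f x *+ (p ^ beta) = 0) ->
  forall (s : seq I) t,
  (\sum_i (p ^ a i - 1) + (beta - 1) * ((p - 1) * p ^ m.-1) <
     t * ((p - 1) * p ^ m.-1) + size s)%N ->
  forall x, diffs (map g s) f x *+ (p ^ t) = 0.
Proof.
move=> p_pr a_bd f_per f_tors s.
set w := ((p - 1) * _)%N; set S := (\sum_i _)%N.
have [n] := ubnP (size s); elim: n s => // n IH s lt_sn t wt x.
case: (pselect (exists i, (p ^ a i <= count_mem i s)%N)) => [[i le_i]|/forallNP nbig].
  have [s' perm_s] : exists s' : seq I, perm_eq s (nseq (p ^ a i) i ++ s') :=
    perm_count_nseq le_i.
  rewrite (perm_diffs f (perm_map g perm_s)) map_cat map_nseq diffs_cat.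
  have sz : size s = (p ^ a i + size s')%N by rewrite (perm_size perm_s) size_cat size_nseq.
  have q_gt0 : (0 < p ^ a i)%N by rewrite expn_gt0 prime_gt0.
  case E : (p ^ a i)%N q_gt0 => [//|q] _.
  rewrite diffs_nseq_periodic; last first.
    by rewrite -E; apply: diffs_invariant => y; apply: f_per.
  rewrite mulNrn -sumrMnl big1 ?oppr0 // => k _.
  have [|j [dvd_j wt_j]] := bin_pfactor_weight p_pr (a_bd i) (k := k.+1).
    by rewrite E /= ltnS ltn_ord.
  (* The factor [p^j] of the binomial coefficient raises [t] by [j], while the list gets shorter. *)
  rewrite -E -mulrnA; apply: (@mulrn_dvd_eq0 _ _ (p ^ (t + j))).
    by rewrite expnD mulnC dvdn_mul.
  rewrite -map_nseq -diffs_cat -map_cat; have := ltn_ord k; rewrite -/w in wt_j.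
  move=> lt_kq; apply: IH; rewrite size_cat size_nseq; first by lia.
  move: wt wt_j; rewrite mulnDl sz E; lia.
(* No rewriting applies, so [s] is short and the excess weight lies in [t]: [p^beta] divides
   [p^t]. *)
have le_s : (size s <= S)%N.
  by rewrite size_count_sum; apply: leq_sum => i _; have /negP := nbig i; lia.
have : ((beta - 1) * w < t * w)%N by lia.
rewrite ltn_mul2r => /andP[_ lt_t]; apply: (@mulrn_dvd_eq0 _ _ (p ^ beta)).
  by rewrite dvdn_exp2l //; lia.
exact: diffs_torsion.
Qed.

(* The first hypothesis says that [M] and the elements [g i] generate [A]. *)
Lemma vanishes_on_generators (A B : zmodType) (I : Type) (g : I -> A) (M : A -> Prop) k (f : A -> B) :
  (forall h : A -> B, (forall x y, M y -> h (x + y) = h x) ->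
     (forall i x, h (x + g i) = h x) -> forall x y, h (x + y) = h x) ->
  (forall x y, M y -> f (x + y) = f x) ->
  (forall s : seq I, size s = k -> forall x, diffs (map g s) f x = 0) ->
  forall s : seq A, size s = k -> forall x, diffs s f x = 0.
Proof.
move=> h_gen; elim: k f => [|k IH] f fM van s; first by move/size0nil => ->; apply: (van [::]).
(* [diffs s f] is invariant under [M] and, by induction on [Delta (g i) f], under each [g i]; hence
   one more difference kills it. *)
case: s => // b s [sz] x; rewrite /= /Delta h_gen ?subrr //.
  by move=> y z Mz; apply: diffs_invariant => u; apply: fM.
move=> i y; apply/eqP; rewrite -subr_eq0; apply/eqP.
rewrite -[LHS]/(Delta (g i) (diffs s f) y) -diffs_Delta; apply: IH sz y.
  by move=> u v Mv; rewrite /Delta addrAC !(fM _ _ Mv).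
by move=> s' sz' u; rewrite diffs_Delta; apply: (van (i :: s')); rewrite /= sz'.
Qed.

(** * Lower bound *)

(* In the expansion of [D^(q - 1 + (beta + 1) w)], with [q] and [w] as in [diffs_weight],
   only the term of index [p^(a - 1)] has minimal weight; hence
   [D^(q - 1 + beta w) = unit * p^beta * D^(q - 1)] modulo [p^(beta + 1)]. *)
Lemma diffs_top_weight (A B : zmodType) (g : A) (p a beta : nat) (f : A -> B) :
  prime p -> (0 < a)%N ->
  (forall x, f (x + g *+ (p ^ a)) = f x) ->
  (forall x, f x *+ (p ^ beta.+1) = 0) ->
  forall x, diffs (nseq (p ^ a - 1 + beta * ((p - 1) * p ^ a.-1)) g) f x = 0 ->
  diffs (nseq (p ^ a - 1) g) f x *+ (p ^ beta) = 0.
Proof.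
move=> p_pr a_gt0; have p_gt1 := prime_gt1 p_pr.
set w := ((p - 1) * _)%N; elim: beta f => [|beta IH] f f_per f_tors x.
  by rewrite mul0n addn0 expn0 mulr1n.
have Epa : (p ^ a = p * p ^ a.-1)%N by rewrite -expnS prednK.
have pa1_gt0 : (0 < p ^ a.-1)%N by rewrite expn_gt0 prime_gt0.
have Ew : (w + p ^ a.-1 = p ^ a)%N by rewrite Epa /w; nia.
have pa1_lt : (p ^ a.-1 < p ^ a)%N by rewrite Epa; nia.
have w_gt0 : (0 < w)%N by lia.
(* [m] is what remains after splitting off one factor [D^(p^a)], the one to be rewritten. *)
pose m := (beta * w + w - 1)%N; pose h := diffs (nseq m g) f.
have -> : (p ^ a - 1 + beta.+1 * w = p ^ a + m)%N by rewrite /m mulSn; lia.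
rewrite nseqD diffs_cat -/h.
have h_per y : h (y + g *+ (p ^ a)) = h y by apply: diffs_invariant.
case Eq : (p ^ a)%N (h_per x) => [|q] h_perx; first by lia.
rewrite diffs_nseq_periodic // => /eqP; rewrite oppr_eq0.
have k0_lt : ((p ^ a.-1).-1 < q)%N by lia.
(* Every other term has surplus weight by [bin_pfactor_weight], so [diffs_weight] kills it. *)
have -> : \sum_(k < q) diffs (nseq k.+1 g) h x *+ 'C(q.+1, k.+1) =
    diffs (nseq (p ^ a.-1) g) h x *+ 'C(q.+1, p ^ a.-1).
  rewrite (bigD1 (Ordinal k0_lt)) // big1; last first.
    move=> k /eqP k_ne; have lt_kq := ltn_ord k.
    have a_bd : (0 < a <= a)%N by rewrite a_gt0 leqnn.
    have k_bd : (0 < k.+1 < p ^ a)%N by rewrite Eq ltnS.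
    have [j [dvd_j wt_j]] := bin_pfactor_weight p_pr a_bd k_bd.
    rewrite -Eq; apply: mulrn_dvd_eq0 dvd_j _.
    have ne : (k.+1 != p ^ a.-1)%N.
      by apply/eqP => E; apply: k_ne; apply: val_inj => /=; rewrite -E.
    rewrite ne -/w in wt_j.
    have := @diffs_weight _ _ _ (fun _ : 'I_1 => g) (fun=> a) p a beta.+2 f p_pr _ _ f_tors
              (nseq (k.+1 + m) ord0) j _ x.
    rewrite map_nseq (nseqD _ _ g) diffs_cat; apply=> //.
    rewrite big_ord1 -/w subSS subn0 size_nseq mulSn /m; lia.
  by rewrite -[in RHS](prednK pa1_gt0); apply: addr0.
(* One factor [p] splits off and passes to [f' = p f], to which induction applies; the cofactor is
   prime to [p] and can be cancelled. *)
have -> : 'C(q.+1, p ^ a.-1) = (p * 'C(q, (p ^ a.-1).-1))%N.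
  apply/eqP; rewrite -(eqn_pmul2l pa1_gt0) -[X in (X * 'C(_, X))%N == _]prednK //.
  by rewrite -mul_bin_diag /= -Eq Epa mulnA (mulnC p) eqxx.
move=> /eqP; rewrite mulrnA /h -diffs_cat -nseqD.
pose f' := fun y => f y *+ p.
have -> : (p ^ a.-1 + m = p ^ a - 1 + beta * w)%N by rewrite /m; lia.
move=> y0; have {}y0 : diffs (nseq (p ^ a - 1 + beta * w) g) f' x = 0.
  have f'_tors y : f' y *+ (p ^ beta.+1) = 0 by rewrite /f' -mulrnA -expnS.
  have cop : coprime (p ^ beta.+1) 'C(q, (p ^ a.-1).-1).
    rewrite coprime_pexpl //; have := @coprime_bin_pfactor_pred p a (p ^ a.-1).-1 p_pr.
    by rewrite Eq; apply; lia.
  apply: (mulrn_coprime_eq0 cop); [exact: diffs_torsion|by rewrite diffs_mulrn].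
have := IH f' _ _ x y0; rewrite /f' diffs_mulrn -mulrnA -expnS -Eq; apply.
- by move=> y; rewrite f_per.
- by move=> y; rewrite -mulrnA -expnS.
Qed.

(** * Supports of iterated differences and indicator functions *)

Lemma diffs_nseq_support (A B : zmodType) (g : A) n (f : A -> B) x :
  diffs (nseq n g) f x <> 0 -> exists j, f (x + g *+ j) <> 0.
Proof.
elim: n x => [|n IH] x; first by exists 0%N; rewrite addr0.
rewrite /= /Delta; case: (pselect (diffs (nseq n g) f x = 0)) => [->|/IH//].
by rewrite subr0 => /IH[j]; rewrite -addrA -mulrS; exists j.+1.
Qed.

(** Among the points [x + j g] only [x] contributes, with sign [(-1)^n], recorded as a
    disjunction. *)
Lemma diffs_nseq_isolated (A B : zmodType) (g : A) n (f : A -> B) x :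
  (forall j, (0 < j <= n)%N -> f (x + g *+ j) = 0) ->
  diffs (nseq n g) f x = f x \/ diffs (nseq n g) f x = - f x.
Proof.
elim: n f => [|n IH] f f0; first by left.
rewrite diffs_nseqS; have Dx : Delta g f x = - f x.
  by rewrite /Delta -[g]mulr1n f0 ?sub0r.
case: (IH (Delta g f)) => [j /andP[j_gt0 le_j]|->|->].
- by rewrite /Delta -addrA -mulrSr !f0 ?subrr //; lia.
- by right.
- by left; rewrite Dx opprK.
Qed.

(** Together with [M (g i *+ q i)], this says that the images of the [g i] in [A / M] span a direct
    sum of cyclic groups of orders [q i]. Using [M]-invariant functions on [A] avoids forming the
    quotient. *)
Definition independent_mod (A : zmodType) (M : A -> Prop) (g : nat -> A) (q : nat -> nat) r :=
  forall c : nat -> int, M (\sum_(i < r) g i *~ c i) ->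
  forall i, (i < r)%N -> ((q i)%:Z %| c i)%Z.

Lemma independent_mod_pred (A : zmodType) (M : A -> Prop) (g : nat -> A) (q : nat -> nat) r :
  independent_mod M g q r.+1 -> independent_mod M g q r.
Proof.
move=> ind c Mc i lt_i.
have := ind (fun j => if (j < r)%N then c j else 0) _ i (ltnW lt_i).
rewrite lt_i; apply; rewrite big_ord_recr /= ltnn mulr0z addr0.
by under eq_bigr => j _ do rewrite ltn_ord.
Qed.

(** For positive [q i], the longest monomial in which no [g i] occurs [q i] times. *)
Fixpoint box (A : zmodType) (g : nat -> A) (q : nat -> nat) r : seq A :=
  if r is r'.+1 then nseq (q r' - 1) (g r') ++ box g q r' else [::].

Lemma size_box (A : zmodType) (g : nat -> A) q r :
  size (box g q r) = (\sum_(i < r) (q i - 1))%N.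
Proof.
elim: r => [|r IH] /=; first by rewrite big_ord0.
by rewrite size_cat size_nseq IH big_ord_recr addnC.
Qed.

Lemma box_split0 (A : zmodType) (g : nat -> A) q r :
  exists t, box g q r.+1 = t ++ nseq (q 0%N - 1) (g 0%N).
Proof.
elim: r => [|r [t E]]; first by exists [::]; rewrite /= cats0.
by exists (nseq (q r.+1 - 1) (g r.+1) ++ t); rewrite -catA -E.
Qed.

(** The support stays in [M] plus the span of the generators used so far. By independence it misses
    the multiples [j] of the next generator [g r] with [0 < j < q r], so the value at zero changes
    at most by a sign. *)
Lemma diffs_box (A B : zmodType) (M : A -> Prop) (g : nat -> A) q r (f : A -> B) :
  independent_mod M g q r -> (forall x, f x <> 0 -> M x) ->
  (forall x, diffs (box g q r) f x <> 0 ->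
     exists c : nat -> int, M (x + \sum_(i < r) g i *~ c i)) /\
  (diffs (box g q r) f 0 = f 0 \/ diffs (box g q r) f 0 = - f 0).
Proof.
move=> ind supp; elim: r ind => [|r IH] ind.
  split; last by left.
  by move=> x /supp Mx; exists (fun=> 0); rewrite big_ord0 addr0.
have [{}supp val] := IH (independent_mod_pred ind).
rewrite /= diffs_cat; set h := diffs (box g q r) f in supp val *.
have step x (c : nat -> int) (j : nat) :
    M (x + g r *+ j + \sum_(i < r) g i *~ c i) ->
    exists c' : nat -> int, c' r = j /\ M (x + \sum_(i < r.+1) g i *~ c' i).
  move=> Mx; exists (fun i => if i == r then j%:Z else c i); rewrite eqxx; split=> //.
  rewrite big_ord_recr /= eqxx -pmulrn (eq_bigr (fun i : 'I_r => g i *~ c i)).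
    by rewrite addrA addrAC.
  by move=> i _; rewrite ltn_eqF.
split.
  move=> x /diffs_nseq_support[j /supp[c /step[c' [_ Mc']]]]; by exists c'.
have [j /andP[j_gt0 le_j]|->|->] := @diffs_nseq_isolated _ _ (g r) (q r - 1) h 0.
- apply: contrapT => /supp[c /step[c' [c'r]]]; rewrite add0r => /ind /(_ r (ltnSn r)).
  rewrite c'r /dvdz /= => /dvdn_leq; lia.
- exact: val.
- by case: val => ->; [right | left; rewrite opprK].
Qed.

(** The box of differences takes the value [b] or [- b] at zero. If the further differences along
    [g 0] gave zero there, [diffs_top_weight] would yield [p^beta b = 0]. *)
Lemma indicator_not_vanishing (A B : zmodType) (M : A -> Prop) (g : nat -> A)
    (a : nat -> nat) r p beta (b : B) :
  prime p -> M 0 -> (forall x y, M x -> M y -> M (x - y)) ->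
  (forall i, (i <= r)%N -> (0 < a i)%N /\ M (g i *+ (p ^ a i))) ->
  independent_mod M g (fun i => p ^ a i)%N r.+1 ->
  b *+ (p ^ beta.+1) = 0 -> b *+ (p ^ beta) <> 0 ->
  exists s : seq A,
    size s = (\sum_(i < r.+1) (p ^ a i - 1) + beta * ((p - 1) * p ^ (a 0%N).-1))%N /\
    diffs s (fun x => if `[< M x >] then b else 0) 0 <> 0.
Proof.
move=> p_pr M0 MB a_bd ind bS bN.
pose f x : B := if `[< M x >] then b else 0; rewrite -/f; set w := (beta * _)%N.
have f_inv x y : M y -> f (x + y) = f x.
  move=> My; rewrite /f; congr (if _ then _ else _); apply/asboolP/asboolP => Mx.
    by rewrite -(addrK y x); apply: MB.
  by rewrite -[y]opprK -[- y]sub0r; apply: (MB) => //; apply: (MB).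
pose q i := (p ^ a i)%N.
exists (nseq w (g 0%N) ++ box g q r.+1); split.
  by rewrite size_cat size_nseq size_box addnC.
have [t E] := box_split0 g q r; have [a0 Mg0] := a_bd 0%N isT.
rewrite E !diffs_cat (diffs_comm t) -diffs_cat -nseqD addnC.
move=> /diffs_top_weight top.
have : diffs (nseq (p ^ a 0%N - 1) (g 0%N)) (diffs t f) 0 *+ p ^ beta = 0.
  apply: top => //.
    by move=> x; apply: diffs_invariant => y; apply: f_inv.
  by apply: diffs_torsion => x; rewrite /f; case: ifP; rewrite ?mul0rn.
rewrite diffs_comm -diffs_cat -E; have [|_] := diffs_box ind (f := f).
  by move=> x; rewrite /f; case: asboolP.
have -> : f 0 = b by rewrite /f; case: asboolP.
by case=> -> //; rewrite mulNrn => /eqP; rewrite oppr_eq0 => /eqP.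
Qed.

(** * Generation modulo a subgroup and the two degree bounds *)

Lemma lincombD (A : zmodType) (g : nat -> A) k (c d : nat -> int) :
  \sum_(i < k) g i *~ c i + \sum_(i < k) g i *~ d i = \sum_(i < k) g i *~ (c i + d i).
Proof. by rewrite -big_split; apply: eq_bigr => i _; rewrite mulrzDr. Qed.

Lemma lincombMz (A : zmodType) (g : nat -> A) k (c : nat -> int) n :
  (\sum_(i < k) g i *~ c i) *~ n = \sum_(i < k) g i *~ (c i * n).
Proof. by rewrite mulrz_suml; apply: eq_bigr => i _; rewrite mulrzA. Qed.

Definition subgroup (A : zmodType) (M : A -> Prop) :=
  M 0 /\ forall x y, M x -> M y -> M (x - y).

Lemma subgroupN (A : zmodType) (M : A -> Prop) x : subgroup M -> M x -> M (- x).
Proof. by case=> M0 MB Mx; rewrite -sub0r; apply: MB. Qed.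

Lemma subgroupD (A : zmodType) (M : A -> Prop) x y : subgroup M -> M x -> M y -> M (x + y).
Proof. by move=> sM Mx /(subgroupN sM) My; rewrite -[y]opprK; apply: sM.2. Qed.

Lemma subgroupMz (A : zmodType) (M : A -> Prop) x (n : int) : subgroup M -> M x -> M (x *~ n).
Proof.
move=> sM Mx; have Mn k : M (x *+ k).
  by elim: k => [|k IH]; [exact: sM.1 | rewrite mulrS; apply: subgroupD].
by case: n => n; [exact: Mn | rewrite NegzE mulrNz; apply: subgroupN => //; apply: Mn].
Qed.

Definition generated_mod (A : zmodType) (M : A -> Prop) (g : nat -> A) r :=
  forall x, exists c : nat -> int, M (x - \sum_(i < r) g i *~ c i).

Lemma generated_mod_invariant (A B : zmodType) (M : A -> Prop) (g : nat -> A) r (h : A -> B) :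
  generated_mod M g r -> (forall x y, M y -> h (x + y) = h x) ->
  (forall (i : 'I_r) x, h (x + g i) = h x) -> forall x y, h (x + y) = h x.
Proof.
move=> gen hM hg x y; have [c Mc] := gen y.
rewrite -(subrK (\sum_(i < r) g i *~ c i) y) addrA addrAC hM // {Mc}.
elim/big_rec: _ => [|i s _ IH]; first by rewrite addr0.
rewrite addrCA addrC -[RHS]IH; move: (x + s) => z {IH}.
have hgn n u : h (u + g i *+ n) = h u.
  by elim: n u => [|n IH] u; rewrite ?addr0 // mulrSr addrA hg.
case: (c i) => n; first exact: hgn.
by rewrite NegzE mulrNz -(hgn n.+1) subrK.
Qed.

(** The case [t = 0] of [diffs_weight], extended from generators to arbitrary lists by
    [vanishes_on_generators]. *)
Lemma vanishes_generated (A B : zmodType) (M : A -> Prop) (I : finType) (g : I -> A)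
    (a : I -> nat) p m beta (f : A -> B) :
  prime p -> (forall i, (0 < a i <= m)%N) -> (forall i, M (g i *+ (p ^ a i))) ->
  (forall h : A -> B, (forall x y, M y -> h (x + y) = h x) ->
     (forall i x, h (x + g i) = h x) -> forall x y, h (x + y) = h x) ->
  (forall x y, M y -> f (x + y) = f x) ->
  (forall x, f x *+ (p ^ beta) = 0) ->
  vanishes f (\sum_i (p ^ a i - 1) + (beta - 1) * ((p - 1) * p ^ m.-1)).
Proof.
move=> p_pr a_bd Mg gen fM f_tors; apply: (vanishes_on_generators gen fM) => s sz x.
rewrite -[LHS]mulr1n -[1%N](expn0 p).
apply: (diffs_weight p_pr a_bd _ f_tors) => [i y|]; first exact: fM.
by rewrite sz mul0n add0n.
Qed.

(** The indicator of [M] has finite degree by [vanishes_generated], so it counts in [delta0];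
    [indicator_not_vanishing] bounds its degree from below. *)
Lemma delta0_ge (A B : zmodType) (M : A -> Prop) (g : nat -> A) (a : nat -> nat) r p beta (b : B) n :
  prime p -> subgroup M ->
  (forall i, (i <= r)%N -> (0 < a i)%N /\ M (g i *+ (p ^ a i))) ->
  independent_mod M g (fun i => p ^ a i)%N r.+1 -> generated_mod M g r.+1 ->
  b *+ (p ^ beta.+1) = 0 -> b *+ (p ^ beta) <> 0 ->
  ele (delta0 A B) (EFin n) ->
  (\sum_(i < r.+1) (p ^ a i - 1) + beta * ((p - 1) * p ^ (a 0%N).-1) <= n)%N.
Proof.
move=> p_pr sM a_bd ind gen bS bN /delta0_le dn.
have [s [sz ns]] := indicator_not_vanishing p_pr sM.1 sM.2 a_bd ind bS bN.
move: ns; set f := fun x : A => _ => ns.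
rewrite leqNgt; apply/negP; rewrite -sz => lt_n; apply: ns.
have vf : vanishes f n.
  apply: dn; eexists.
  apply: (@vanishes_generated _ _ M _ (fun i : 'I_r.+1 => g i) (fun i => a i) p
            (\max_(i < r.+1) a i) beta.+1) => //.
  - move=> i; have [-> _] := a_bd i (ltn_ord i).
    exact: (leq_bigmax (F := fun j : 'I_r.+1 => a j)).
  - by move=> i; have [] := a_bd i (ltn_ord i).
  - by move=> h hM hg; apply: generated_mod_invariant gen hM _.
  - move=> x y My; rewrite /f; congr (if _ then _ else _); apply/asboolP/asboolP => Mx.
      by rewrite -(addrK y x); apply: sM.2.
    exact: subgroupD.
  - by move=> x; rewrite /f; case: ifP; rewrite ?mul0rn.
have lt_n' : (n <= (size s).-1)%N by lia.
by apply: (vanishes_monotone lt_n' vf); lia.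
Qed.

(** * Elementary abelian quotients *)

Lemma prime_bezoutz p (t : int) : prime p -> ~~ (p%:Z %| t)%Z ->
  exists u v : int, u * p%:Z + v * t = 1.
Proof.
move=> p_pr ndvd; have /coprimezP[[u v] E] : coprimez p%:Z t.
  by rewrite /coprimez /gcdz /= eqz_nat -/(coprime _ _) prime_coprime.
by exists u, v.
Qed.

(** A Nakayama argument: a family spanning [G] modulo [pG] spans [G], as [p^E] kills [G]. Hence an
    independent family of fewer than [N] elements can be extended. *)
Lemma ex_independent_mod_p (G : zmodType) p E N :
  prime p -> (forall x : G, x *+ (p ^ E) = 0) ->
  (forall k (g : nat -> G), (k < N)%N -> exists x, forall c : nat -> int, x <> \sum_(i < k) g i *~ c i) ->
  exists g, independent_mod (fun x : G => exists y, x = y *+ p) g (fun=> p) N.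
Proof.
move=> p_pr expE; elim: N => [|N IH] big; first by exists (fun=> 0) => c _ i.
have [k h lt_k|g ind] := IH; first by apply: big; apply: ltnW.
have [x nx] : exists x, forall c : nat -> int, ~ exists y, x - \sum_(i < N) g i *~ c i = y *+ p.
  apply: contrapT => /forallNP nx.
  have {}nx x : exists (c : nat -> int) y, x = \sum_(i < N) g i *~ c i + y *+ p.
    have /existsNP[c /contrapT[y Ey]] := nx x.
    by exists c, y; rewrite -Ey addrC subrK.
  (* Substituting the congruence into its own error term raises the power of [p]. *)
  have gen e x : exists (c : nat -> int) y, x = \sum_(i < N) g i *~ c i + y *+ (p ^ e).
    elim: e => [|e [c [y ->]]].
      by exists (fun=> 0), x; rewrite big1 ?add0r // => i _; rewrite mulr0z.
    have [d [z ->]] := nx y; exists (fun i => c i + d i * (p ^ e)%:Z), z.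
    rewrite mulrnDl addrA -mulrnA -expnS [(\sum_(i < N) g i *~ d i) *+ _]pmulrn lincombMz.
    by rewrite (lincombD g N c (fun i => d i * (p ^ e)%N%:Z)).
  have [x nxx] := big N g (ltnSn N); have [c [y]] := gen E x.
  by rewrite expE addr0; apply: nxx.
exists (fun i => if i == N then x else g i) => c; rewrite big_ord_recr /= eqxx.
rewrite (eq_bigr (fun i : 'I_N => g i *~ c i)); last by move=> i _; rewrite ltn_eqF.
set S := \sum_(i < N) _; move=> [y Ey].
(* Otherwise Bezout's identity puts [x] in the span of the [g i] modulo [pG]. *)
have pcN : (p%:Z %| c N)%Z.
  apply: contrapT => /negP /(prime_bezoutz p_pr)[u [v Euv]].
  apply: (nx (fun i => c i * - v)); exists (x *~ u + y *~ v).
  rewrite -lincombMz -/S mulrNz opprK -[X in X + _]mulr1z -Euv mulrzDr.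
  rewrite mulrnDl !pmulrn -!mulrzA (mulrC v p%:Z) (mulrzA y) -pmulrn -Ey mulrzDl.
  by rewrite -addrA; congr (_ + _); rewrite addrC -mulrzA (mulrC v).
move=> i; rewrite ltnS leq_eqVlt => /orP[/eqP-> //|lt_i]; apply: ind lt_i.
have /dvdzP[d Ed] := pcN; exists (y - x *~ d).
by rewrite mulrnBl -Ey Ed [x *~ d *+ p]pmulrn -mulrzA addrK.
Qed.

(* A subgroup containing [pG] and maximal for keeping the [g i] independent is a
   complement, modulo [pG], of the subgroup generated by the [g i]. *)
Lemma ex_elementary_quotient (G : zmodType) p E N :
  prime p -> (forall x : G, x *+ (p ^ E) = 0) ->
  (forall k (g : nat -> G), (k < N)%N -> exists x, forall c : nat -> int, x <> \sum_(i < k) g i *~ c i) ->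
  exists (g : nat -> G) (M : G -> Prop),
    [/\ subgroup M, forall x, M (x *+ p), independent_mod M g (fun=> p) N &
        generated_mod M g N].
Proof.
move=> p_pr expE big; have [g indp] := ex_independent_mod_p p_pr expE big.
pose good (M : set G) := [/\ subgroup M, forall x, M (x *+ p) & independent_mod M g (fun=> p) N].
have [|M [[M0|[sM Mp ind]] maxM]] := @Zorn_bigcup G (fun M : set G => M = set0 \/ good M).
- move=> F FP Ftot; case: (pselect (exists X, F X /\ good X)) => [[X [FX gX]]|noX]; last first.
    left; rewrite -subset0 => x [Y FY Yx]; case: (FP _ FY) => [Y0|gY]; first by rewrite Y0 in Yx.
    by apply: noX; exists Y.
  have Fgood Y y : F Y -> Y y -> good Y by move=> FY Yy; case: (FP _ FY) => // Y0; rewrite Y0 in Yy.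
  right; have [[X0 _] Xp _] := gX; split.
  + split; first by exists X.
    move=> x y [Y FY Yx] [Z FZ Zy]; have [[_ YB] _ _] := Fgood _ _ FY Yx.
    have [[_ ZB] _ _] := Fgood _ _ FZ Zy.
    case: (Ftot _ _ FY FZ) => sub; first by exists Z => //; apply: ZB => //; apply: sub.
    by exists Y => //; apply: YB => //; apply: sub.
  + by move=> x; exists X.
  + by move=> c [Y FY Yc]; have [_ _] := Fgood _ _ FY Yc; apply.
- exfalso; apply: (maxM (fun x => exists y, x = y *+ p)).
    rewrite M0; split; first by move=> x.
    by move=> /(_ 0); apply; exists 0; rewrite mul0rn.
  right; split=> //; last by move=> x; exists x.
  split; first by exists 0; rewrite mul0rn.
  by move=> _ _ [x ->] [y ->]; exists (x - y); rewrite mulrnBl.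
exists g, M; split=> // x; apply: contrapT => /forallNP nx.
(* For [x] outside [M] plus the span of the [g i], [M + Zx] would be a larger good subgroup. *)
pose M' : set G := fun z => exists m (t : int), M m /\ z = m + x *~ t.
apply: (maxM M').
  split; first by move=> z Mz; exists z, 0; rewrite mulr0z addr0.
  move=> /(_ x) sub; apply: (nx (fun=> 0)); rewrite big1 ?subr0; last by move=> i _; rewrite mulr0z.
  by apply: sub; exists 0, 1; rewrite add0r; split=> //; apply: sM.1.
right; split.
- split; first by exists 0, 0; rewrite mulr0z addr0; split=> //; apply: sM.1.
  move=> _ _ [m [t [Mm ->]]] [n [u [Mn ->]]]; exists (m - n), (t - u).
  by split; [apply: sM.2 | rewrite mulrzBr opprD addrACA].
- by move=> y; exists (y *+ p), 0; rewrite mulr0z addr0.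
move=> c [m [t [Mm Ec]]]; apply: ind; rewrite Ec; apply: subgroupD => //.
(* If [p] did not divide [t], Bezout's identity would put [x] in [M] plus the span. *)
have /dvdzP[d ->] : (p%:Z %| t)%Z; last by rewrite mulrzA -pmulrn.
apply: contrapT => /negP /(prime_bezoutz p_pr)[u [v Euv]]; apply: (nx (fun i => c i * v)).
rewrite -lincombMz Ec -[X in X - _]mulr1z -Euv mulrzDr mulrzDl opprD mulrzA -pmulrn.
rewrite -(mulrzA x t) (mulrC t) addrACA subrr addr0; apply: sM.2; first exact: Mp.
exact: subgroupMz.
Qed.

(** * Primary components *)

Lemma Ptors_eq0_pfactor (G : zmodType) p (x : Ptors G p) : exists k, x *+ (p ^ k) = 0.
Proof.
have /asboolP[k [_ xk]] := valP x; exists k; apply: val_inj.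
by rewrite raddfMn raddf0.
Qed.

Definition prime_to_torsion (G : zmodType) p (x : G) := exists m, coprime p m /\ x *+ m = 0.

Lemma prime_to_torsionB (G : zmodType) p (x y : G) :
  prime_to_torsion p x -> prime_to_torsion p y -> prime_to_torsion p (x - y).
Proof.
move=> [m [cm xm]] [n [cn yn]]; exists (m * n)%N; rewrite coprimeMr cm cn; split=> //.
by rewrite mulrnBl mulrnA xm mulnC mulrnA yn !mul0rn subrr.
Qed.

Lemma prime_to_torsion_Ptors (G : zmodType) p (x : Ptors G p) :
  prime_to_torsion p (val x) -> x = 0.
Proof.
move=> [m [cm xm]]; have [k xk] := Ptors_eq0_pfactor x.
apply: (mulrn_coprime_eq0 (coprimeXl k cm) xk); apply: val_inj.
by rewrite raddfMn raddf0.
Qed.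

(** If [n = m p^k] kills [x], with [m] prime to [p], take [y = e x] with [e = 1] modulo [p^(k+1)]
    and [e = 0] modulo [m]. *)
Lemma primary_component_exists (G : zmodType) p (x : G) : torsion_group G -> prime p ->
  exists y : Ptors G p, prime_to_torsion p (x - val y).
Proof.
move=> tG p_pr; have [n [n_gt0 xn]] := tG x.
have [m cm En] := pfactor_coprime p_pr n_gt0; set k := logn p n in En.
(* The exponent [k.+1] is positive, as [ptors] asks, and makes the modulus exceed one, so that [e]
   is nonzero. *)
have cKm : coprime (p ^ k.+1) m by rewrite coprime_pexpl.
pose e := chinese (p ^ k.+1) m 1 0.
have /eqP e1 : e = 1 %[mod p ^ k.+1] by apply: chinese_modl.
have e0 : (m %| e)%N by rewrite /dvdn; apply/eqP; rewrite chinese_modr // mod0n.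
have y_tors : (x *+ e) \in ptors p.
  apply/asboolP; exists k.+1; split=> //; rewrite -mulrnA; apply: mulrn_dvd_eq0 xn.
  by rewrite En dvdn_mul // dvdn_exp2l.
exists (Sub (x *+ e) y_tors); exists m; split=> //; rewrite SubK.
have e_gt0 : (0 < e)%N.
  case: e e1 {e0 y_tors} => // e1; rewrite mod0n modn_small in e1 => //.
  by rewrite (ltn_exp2l 0) ?prime_gt1.
rewrite eqn_mod_dvd // in e1.
rewrite -{1}[x]mulr1n -opprB -mulrnBr // mulNrn -mulrnA.
rewrite (mulrn_dvd_eq0 _ xn) ?oppr0 // En mulnC dvdn_mul //.
by apply: dvdn_trans e1; rewrite dvdn_exp2l.
Qed.

Definition primary_component (G : zmodType) (tG : torsion_group G) p (p_pr : prime p) (x : G) :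
  Ptors G p := sval (cid (primary_component_exists x tG p_pr)).

Lemma primary_componentP (G : zmodType) (tG : torsion_group G) p (p_pr : prime p) (x : G) :
  prime_to_torsion p (x - val (primary_component tG p_pr x)).
Proof. exact: (svalP (cid (primary_component_exists x tG p_pr))). Qed.

(** Two candidates differ by a [p]-primary element of order prime to [p], which is zero. Additivity
    follows from this. *)
Lemma primary_component_unique (G : zmodType) (tG : torsion_group G) p (p_pr : prime p) (x : G) y :
  prime_to_torsion p (x - val y) -> primary_component tG p_pr x = y.
Proof.
move=> xy; apply/esym/eqP; rewrite -subr_eq0; apply/eqP/prime_to_torsion_Ptors.
have := prime_to_torsionB (primary_componentP tG p_pr x) xy.
by rewrite opprB addrC subrKA raddfB.
Qed.

Lemma primary_componentB (G : zmodType) (tG : torsion_group G) p (p_pr : prime p) (x y : G) :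
  primary_component tG p_pr (x - y) = primary_component tG p_pr x - primary_component tG p_pr y.
Proof.
apply: primary_component_unique.
set u := primary_component _ _ x; set v := primary_component _ _ y.
have -> : x - y - val (u - v) = x - val u - (y - val v).
  rewrite (raddfB val) !opprB addrACA [RHS]addrACA; congr (_ + _); exact: addrC.
by apply: prime_to_torsionB; apply: primary_componentP.
Qed.

Lemma primary_componentD (G : zmodType) (tG : torsion_group G) p (p_pr : prime p) (x y : G) :
  primary_component tG p_pr (x + y) = primary_component tG p_pr x + primary_component tG p_pr y.
Proof. by rewrite -[x in RHS](addrK y) primary_componentB subrK. Qed.

Lemma primary_component_val (G : zmodType) (tG : torsion_group G) p (p_pr : prime p) (x : Ptors G p) :
  primary_component tG p_pr (val x) = x.
Proof.
by apply: primary_component_unique; exists 1%N; rewrite coprimen1 subrr mul0rn.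
Qed.

Lemma primary_component_eq0 (G : zmodType) (tG : torsion_group G) (x : G) :
  (forall p (p_pr : prime p), primary_component tG p_pr x = 0) -> x = 0.
Proof.
move=> x0; have [n [[n_gt0 xn] minn]] := least_nat (tG x).
case: (leqP n 1) => [le_n1|n_gt1].
  by have -> : x = x *+ n by have -> : n = 1%N by [lia].
(* For a prime [p] dividing the least annihilator [n], some [m] prime to [p] kills [x]; minimality
   forces [n], hence [p], to divide [m]. *)
have p_pr := pdiv_prime n_gt1; have := primary_componentP tG p_pr x.
rewrite x0 (raddf0 val) subr0 => -[m [cm xm]].
have d_gt0 : (0 < gcdn n m)%N by rewrite gcdn_gt0 n_gt0.
have /minn le_n : (0 < gcdn n m)%N /\ x *+ gcdn n m = 0.
  by split=> //; apply: mulrn_gcd_eq0.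
have E : gcdn n m = n by apply/eqP; rewrite eqn_leq le_n dvdn_leq ?dvdn_gcdl.
move: cm; rewrite prime_coprime // => /negP[].
by apply: dvdn_trans (pdiv_dvd n) _; rewrite -E dvdn_gcdr.
Qed.

(** * Reduction to primary components *)

Lemma diffs_comp (A A' B : zmodType) (phi : A -> A') (f : A' -> B) s x :
  (forall y z, phi (y + z) = phi y + phi z) ->
  diffs s (f \o phi) x = diffs (map phi s) f (phi x).
Proof. by move=> phiD; elim: s x => //= a s IH x; rewrite /Delta !IH phiD. Qed.

Lemma comp_diffs (A B B' : zmodType) (psi : B -> B') (f : A -> B) s x :
  (forall y z, psi (y - z) = psi y - psi z) ->
  diffs s (psi \o f) x = psi (diffs s f x).
Proof. by move=> psiB; elim: s x => //= a s IH x; rewrite /Delta !IH psiB. Qed.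

(** Descent on the vanishing power of [D = Delta a]: if [D^2 h = 0], then
    [h(y + j a) = h(y) + j D h(y)]. At [j = m] this shows that [m] kills [D h(y)], as does a power
    of [p]. *)
Lemma prime_to_torsion_invariant (A B : zmodType) p (f : A -> B) n a :
  (forall b : B, exists k, b *+ (p ^ k) = 0) -> vanishes f n -> prime_to_torsion p a ->
  forall x, f (x + a) = f x.
Proof.
move=> tB vn [m [cm am]] x; apply/eqP; rewrite -subr_eq0; apply/eqP.
rewrite -[LHS]/(diffs (nseq 1 a) f x).
have {vn} : forall x, diffs (nseq n.+1 a) f x = 0 by move=> y; apply: vn; rewrite size_nseq.
elim: n => [|n IH] D0; first exact: D0.
apply: IH => y; set h := diffs (nseq n a) f.
have Dh z : Delta a h (z + a) = Delta a h z.
  by apply/eqP; rewrite -subr_eq0; apply/eqP/D0.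
have Dj j : Delta a h (y + a *+ j) = Delta a h y.
  by elim: j => [|j IHj]; rewrite ?addr0 // mulrSr addrA Dh.
have hj j : h (y + a *+ j) = h y + Delta a h y *+ j.
  elim: j => [|j IHj]; first by rewrite !addr0.
  by rewrite [_ *+ j.+1 in RHS]mulrSr addrA -IHj -[in RHS](Dj j) /Delta
       [RHS]addrC subrK mulrSr addrA.
have [k Dk] := tB (Delta a h y).
apply: (mulrn_coprime_eq0 (coprimeXl k cm) Dk).
by have := hj m; rewrite am addr0 -{1}[h y]addr0 => /addrI.
Qed.

Lemma delta0_primary (A B : zmodType) : nonzero_group B ->
  torsion_group A -> torsion_group B ->
  delta0 A B = esup (fun d => exists p : nat, prime p /\ d = delta0 (Ptors A p) (Ptors B p)).
Proof.
move=> [b b0] tA tB.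
have key z : ele (delta0 A B) z <->
    forall p, prime p -> ele (delta0 (Ptors A p) (Ptors B p)) z.
  case: z => [|n|]; last by split=> [_ p _|_]; case: (delta0 _ _).
    split=> [/delta0_NegInf[]|h]; first by exists b.
    exfalso; apply: b0; apply: (primary_component_eq0 (tG := tB)) => p p_pr; apply: contrapT => bp.
    apply: (delta0_NegInf (A := Ptors A p) (B := Ptors B p)) (h p p_pr).
    by exists (primary_component tB p_pr b).
  split=> [/delta0_le h p p_pr|h].
    (* Extend [f] to [A] by the projection onto the component, and include its values in [B]. *)
    apply/delta0_le => f [m vm].
    pose pi := primary_component tA p_pr.
    have piD : forall y z, pi (y + z) = pi y + pi z by apply: primary_componentD.
    have E s x : diffs s (val \o (f \o pi)) x = val (diffs (map pi s) f (pi x)).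
      rewrite (comp_diffs (f \o pi) s x (raddfB (val : Ptors B p -> B))).
      by rewrite (diffs_comp f s x piD).
    have vn : vanishes (val \o (f \o pi)) n.
      by apply: h; exists m => s sz x; rewrite E vm ?size_map.
    move=> s sz x; apply: val_inj.
    have := vn (map val s) _ (val x); rewrite size_map E -map_comp => /(_ sz).
    rewrite /pi primary_component_val (eq_map (g := id)) ?map_id //.
    by move=> y /=; rewrite primary_component_val.
  (* Conversely, the [p]-component of [f] is invariant under elements of order prime to [p], so it
     factors through the projection of [A]. *)
  apply/delta0_le => f [m vm] s sz x.
  apply: (primary_component_eq0 (tG := tB)) => p p_pr.
  pose pi := primary_component tA p_pr; pose rho := primary_component tB p_pr.
  have rhoB : forall y z, rho (y - z) = rho y - rho z by apply: primary_componentB.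
  rewrite -/rho -comp_diffs //.
  have vrho : vanishes (rho \o f) m.
    move=> t szt y; rewrite comp_diffs // vm // /rho.
    by apply: primary_component_unique; exists 1%N; rewrite coprimen1 (raddf0 val) subrr mul0rn.
  pose f' := (rho \o f) \o (val : Ptors A p -> A).
  have valD : forall y z : Ptors A p, val (y + z) = val y + val z by exact: (raddfD (val : Ptors A p -> A)).
  have vf' : vanishes f' n.
    apply: (delta0_le _ _ n).1 (h p p_pr) _ _; exists m => t szt y.
    by rewrite /f' diffs_comp // vrho // size_map.
  have piD : forall y z, pi (y + z) = pi y + pi z by apply: primary_componentD.
  have -> : rho \o f = f' \o pi.
    apply: funext => y; rewrite /f' /=.
    have inv := prime_to_torsion_invariant (@Ptors_eq0_pfactor B p) vrho
      (primary_componentP tA p_pr y).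
    by rewrite -[LHS]/((rho \o f) y) -[in LHS](subrK (val (pi y)) y) addrC inv.
  by rewrite diffs_comp // vf' // size_map.
apply: ele_anti; last first.
  by apply/esup_le => _ [p [p_pr ->]]; apply: (key _).1 p_pr; apply: ele_refl.
by apply/key => p p_pr; apply: (esupP _).1; exists p.
Qed.

(** * Bounds for a single prime *)

Lemma Ptors_finite_exponent (G : zmodType) p : prime p -> finite_exponent (Ptors G p) ->
  exists E, forall x : Ptors G p, x *+ (p ^ E) = 0.
Proof.
move=> p_pr [n [n_gt0 expn _]]; exists (logn p n) => x.
have [k xk] := Ptors_eq0_pfactor x; have := mulrn_gcd_eq0 (expn x) xk.
have /(dvdn_pfactor _ _ p_pr)[j _ E] := dvdn_gcdr n (p ^ k).
apply: mulrn_dvd_eq0; rewrite E dvdn_exp2l // -pfactor_dvdn // -E; exact: dvdn_gcdl.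
Qed.

(** If [b] has order [p^k], then [k > beta], and a multiple of [b] by a power of [p] has order
    exactly [p^(beta+1)]. *)
Lemma ex_order_pfactor (G : zmodType) p beta (b : G) :
  (exists k, b *+ (p ^ k) = 0) -> b *+ (p ^ beta) <> 0 ->
  exists c : G, c *+ (p ^ beta.+1) = 0 /\ c *+ (p ^ beta) <> 0.
Proof.
move=> /least_nat[k [bk mink]] bN.
have lt_bk : (beta < k)%N.
  rewrite ltnNge; apply/negP => le_k; apply: bN.
  by apply: mulrn_dvd_eq0 bk; rewrite dvdn_exp2l.
exists (b *+ (p ^ (k - beta.+1))); rewrite -!mulrnA -!expnD; split; first by rewrite subnK.
by move=> /mink; lia.
Qed.

Lemma ex_order_infinite_exponent (G : zmodType) p beta : prime p ->
  ~ finite_exponent (Ptors G p) ->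
  exists c : Ptors G p, c *+ (p ^ beta.+1) = 0 /\ c *+ (p ^ beta) <> 0.
Proof.
move=> p_pr infexp; have [b bN] : exists b : Ptors G p, b *+ (p ^ beta) <> 0.
  apply: contrapT => /forallNP h; apply: infexp.
  have [|n [[n0 nx] minn]] := @least_nat (fun n => (0 < n)%N /\ forall x : Ptors G p, x *+ n = 0).
    by exists (p ^ beta)%N; split; [rewrite expn_gt0 prime_gt0 | move=> x; apply: contrapT (h x)].
  by exists n; split=> // m m0 mx; apply: minn.
exact: ex_order_pfactor (Ptors_eq0_pfactor b) bN.
Qed.

(** Coefficients matter only modulo [N], so a finite family spans finitely many elements. *)
Lemma not_finite_group_span (G : zmodType) N (g : nat -> G) k : (0 < N)%N ->
  (forall x : G, x *+ N = 0) -> ~ finite_group G ->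
  exists x, forall c : nat -> int, x <> \sum_(i < k) g i *~ c i.
Proof.
case: N => // N _ expN infG; apply: contrapT => /forallNP gen; apply: infG.
exists [seq \sum_(i < k) g i *+ F i | F : {ffun 'I_k -> 'I_N.+1}] => x.
have /existsNP[c /contrapT ->] := gen x; apply/mapP.
exists [ffun i : 'I_k => inord `|(c i %% N.+1)%Z|%N]; rewrite ?mem_enum //; apply: eq_bigr => i _.
rewrite ffunE inordK; last by have := @ltz_pmod (c i) N.+1 isT; lia.
rewrite {1}(divz_eq (c i) N.+1) mulrzDr mulrzA -[_ *~ N.+1]pmulrn expN add0r.
by rewrite pmulrn; congr (_ *~ _); have := @modz_ge0 (c i) N.+1 isT; lia.
Qed.

(** Here [G / M] is elementary abelian of rank [r + 1]. The bound is unbounded in each of [p],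
    [beta] and [r], which serves (b), (c) and (d) in turn. *)
Lemma delta0_elementary_ge (G H : zmodType) p E r beta (b : H) n :
  prime p -> (forall x : G, x *+ (p ^ E) = 0) ->
  (forall k (g : nat -> G), (k < r.+1)%N -> exists x, forall c : nat -> int, x <> \sum_(i < k) g i *~ c i) ->
  b *+ (p ^ beta.+1) = 0 -> b *+ (p ^ beta) <> 0 ->
  ele (delta0 G H) (EFin n) -> ((r.+1 + beta) * (p - 1) <= n)%N.
Proof.
move=> p_pr expE big bS bN dn.
have [g [M [sM Mp ind gen]]] := ex_elementary_quotient p_pr expE big.
have := @delta0_ge _ _ M g (fun=> 1%N) r p beta b n p_pr sM _ _ gen bS bN dn.
rewrite /= expn0 muln1 sum_nat_const card_ord expn1 mulnDl; exact.
Qed.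

Lemma delta0_trivial (G H : zmodType) : ~ (nonzero_group G /\ nonzero_group H) ->
  ele (delta0 G H) (EFin 0).
Proof.
move=> triv; apply/delta0_le => f _ [|a[|]] //= _ x; rewrite /Delta.
have triv0 (K : zmodType) : ~ nonzero_group K -> forall y : K, y = 0.
  by move=> h y; apply: contrapT => y0; apply: h; exists y.
case: (pselect (nonzero_group G)) => [G0|/triv0 G0]; last by rewrite (G0 a) addr0 subrr.
by case: (pselect (nonzero_group H)) => [H0|/triv0]; [case: triv | apply].
Qed.

(** All elements of [G] serve as generators, with the crude order [p^(E+1)], whose exponent is
    positive even for [E = 0]. *)
Lemma delta0_finite (G H : zmodType) p E beta : prime p ->
  finite_group G -> (forall x : G, x *+ (p ^ E) = 0) -> (forall x : H, x *+ (p ^ beta) = 0) ->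
  exists n, ele (delta0 G H) (EFin n).
Proof.
move=> p_pr [s sG] expG expH; eexists; apply/delta0_le => f _.
apply: (@vanishes_generated _ _ (fun x => x = 0) _ (fun i : 'I_(size s) => nth 0 s i)
   (fun=> E.+1) p E.+1 beta) => //.
- by move=> i; rewrite /= leqnn.
- by move=> i; rewrite /= expnSr mulrnA expG mul0rn.
- move=> h _ hs x y; have /(nthP 0)[i lt_i <-] := sG y; exact: (hs (Ordinal lt_i)).
- by move=> x _ ->; rewrite addr0.
Qed.

(** Both bounds are used with [M = 0]. Nontriviality excludes an empty [alpha] and [beta = 0], so no
    subtraction in the formula is truncated. *)
Lemma delta0_cyclic_decomposition (G H : zmodType) p (alpha : seq nat) beta :
  prime p -> nonzero_group G -> nonzero_group H ->
  sorted geq alpha -> all (fun a => 0 < a)%N alpha ->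
  cyclic_decomposition G p alpha -> is_exponent H (p ^ beta) ->
  delta0 G H = EFin (\sum_(a <- alpha) (p ^ a - 1)
                     + (beta - 1) * (p - 1) * p ^ (head 0 alpha - 1))%N.
Proof.
move=> p_pr [x x0] [y y0] srt pos [g [gen ker]] [_ expH minH].
have p_gt1 := prime_gt1 p_pr.
case: alpha srt pos gen ker => [|a0 alpha] srt pos gen ker.
  by have [c] := gen x; rewrite big_ord0.
case: beta expH minH => [|beta] expH minH; first by case: y0; have := expH y.
have [b bN] : exists b : H, b *+ (p ^ beta) <> 0.
  apply: contrapT => /forallNP h; have : (p ^ beta.+1 <= p ^ beta)%N.
    by apply: minH => [|z]; [rewrite expn_gt0 prime_gt0 | apply: contrapT (h z)].
  by rewrite leq_exp2l // ltnn.
rewrite [head _ _]/= (subn1 a0) (subn1 beta.+1) [beta.+1.-1]/= -mulnA.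
rewrite (big_nth 0%N) big_mkord; set al := a0 :: alpha in srt pos gen ker *.
have Eal : size al = (size alpha).+1 by [].
have al_pos i : (i < size al)%N -> (0 < nth 0%N al i)%N by move=> lt_i; apply: (allP pos); apply: mem_nth.
have al_le i : (i < size al)%N -> (nth 0%N al i <= a0)%N.
  move=> lt_i; have geq_trans : transitive geq by move=> u v w /= vu uw; apply: leq_trans uw vu.
  exact: (sorted_leq_nth geq_trans (leqnn : reflexive geq) 0%N srt 0 i isT lt_i).
have gker i : (i < size al)%N -> g i *+ (p ^ nth 0%N al i) = 0.
  move=> lt_i; have := (ker (fun j => if j == i then (p ^ nth 0%N al i)%N%:Z else 0)).2.
  rewrite (bigD1 (Ordinal lt_i)) //= eqxx big1 ?addr0 -?pmulrn => [|j ne]; last first.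
    by case: eqP => [E|]; rewrite ?mulr0z //; case/eqP: ne; apply: val_inj.
  by apply=> j _; case: eqP => [->|_]; rewrite ?dvdzz ?dvdz0.
have s0 : subgroup (fun z : G => z = 0) by split=> // u v -> ->; rewrite subrr.
have gen0 : generated_mod (fun z : G => z = 0) g (size al).
  by move=> z; have [c ->] := gen z; exists c; rewrite subrr.
have upper : ele (delta0 G H)
    (EFin (\sum_(i < size al) (p ^ nth 0%N al i - 1) + (beta.+1 - 1) * ((p - 1) * p ^ a0.-1))).
  apply/delta0_le => f _.
  apply: (@vanishes_generated _ _ (fun z => z = 0) _ (fun i : 'I_(size al) => g i)
     (fun i => nth 0%N al i) p a0 beta.+1) => //.
  - by move=> i; rewrite al_pos // al_le.
  - by move=> i; apply: gker.
  - by move=> h hM hg; apply: generated_mod_invariant gen0 hM hg.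
  - by move=> u _ ->; rewrite addr0.
rewrite (subn1 beta.+1) [beta.+1.-1]/= in upper.
apply: ele_anti => //; move: upper; case E : (delta0 G H) => [|n|] //.
  move=> _; exfalso; apply: (@delta0_NegInf G H); first by exists y.
  by rewrite E.
move=> _; rewrite /=.
apply: (@delta0_ge _ _ (fun z => z = 0) g (nth 0%N al) (size alpha) p beta b n) => //.
- by move=> i le_i; split; [apply: al_pos | apply: gker].
- by move=> c /ker.
- by rewrite E /=.
Qed.

(** * Assembly over all primes *)

Theorem theorem3p10 (A B : zmodType)
  (ntA : nonzero_group A) (ntB : nonzero_group B)
  (tA : torsion_group A) (tB : torsion_group B)
  (expA : forall p : nat, prime p -> finite_exponent (Ptors A p)) :
  (* (a) *)
  delta0 A B =
    esup (fun d => exists p : nat, prime p /\ d = delta0 (Ptors A p) (Ptors B p))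
  /\
  (* (b) *)
  ((forall N : nat, exists p : nat, [/\ prime p, (N < p)%N,
        nonzero_group (Ptors A p) & nonzero_group (Ptors B p)]) ->
     delta0 A B = EPosInf)
  /\
  (* (c) *)
  ((exists p : nat, [/\ prime p, nonzero_group (Ptors A p) &
        ~ finite_exponent (Ptors B p)]) ->
     delta0 A B = EPosInf)
  /\
  (* (d) *)
  ((exists p : nat, [/\ prime p, ~ finite_group (Ptors A p) &
        nonzero_group (Ptors B p)]) ->
     delta0 A B = EPosInf)
  /\
  (* (e) *)
  (let P := fun p : nat =>
        [/\ prime p, nonzero_group (Ptors A p) & nonzero_group (Ptors B p)] in
   (exists N : nat, forall p, P p -> (p <= N)%N) ->
   (forall p, P p -> finite_group (Ptors A p) /\ finite_exponent (Ptors B p)) ->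
   (exists n : nat, delta0 A B = EFin n) /\
   forall (alpha : nat -> seq nat) (beta : nat -> nat),
     (forall p, P p ->
        [/\ sorted geq (alpha p), all (fun a => 0 < a)%N (alpha p),
            cyclic_decomposition (Ptors A p) p (alpha p) &
            is_exponent (Ptors B p) (p ^ beta p)]) ->
     delta0 A B =
       esup (fun d => d = EFin 0 \/
         exists p, P p /\
           d = EFin (\sum_(a <- alpha p) (p ^ a - 1)
                     + (beta p - 1) * (p - 1) * p ^ (head 0 (alpha p) - 1))%N)).
Proof.
have primary := delta0_primary ntB tA tB.
have le_primary p n : prime p -> ele (delta0 A B) (EFin n) ->
    ele (delta0 (Ptors A p) (Ptors B p)) (EFin n).
  by move=> p_pr; rewrite primary => /esup_le; apply; exists p.
have lower p r beta (b : Ptors B p) n : prime p ->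
    (forall k (g : nat -> Ptors A p), (k < r.+1)%N ->
       exists x, forall c : nat -> int, x <> \sum_(i < k) g i *~ c i) ->
    b *+ (p ^ beta.+1) = 0 -> b *+ (p ^ beta) <> 0 ->
    ele (delta0 A B) (EFin n) -> ((r.+1 + beta) * (p - 1) <= n)%N.
  move=> p_pr big bS bN /(le_primary _ _ p_pr).
  have [E expE] := Ptors_finite_exponent p_pr (expA p p_pr).
  exact: delta0_elementary_ge big bS bN.
have span0 p : nonzero_group (Ptors A p) -> forall k (g : nat -> Ptors A p), (k < 1)%N ->
    exists x, forall c : nat -> int, x <> \sum_(i < k) g i *~ c i.
  by move=> [x x0] [|//] g _; exists x => c; rewrite big_ord0.
have order1 p : nonzero_group (Ptors B p) ->
    exists b : Ptors B p, b *+ (p ^ 1) = 0 /\ b *+ (p ^ 0) <> 0.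
  by move=> [b b0]; apply: ex_order_pfactor (Ptors_eq0_pfactor b) _.
split=> //; split; [|split; [|split]].
(* A prime [p > n + 1] already gives [p - 1 > n]. *)
- move=> inf; apply: ele_fin_infty => n dn.
  have [p [p_pr lt_p Ap /order1[b [bS bN]]]] := inf n.+1.
  by have := lower p 0%N 0%N b n p_pr (span0 p Ap) bS bN dn; lia.
- move=> [p [p_pr Ap infB]]; apply: ele_fin_infty => n dn.
  have [b [bS bN]] := ex_order_infinite_exponent n p_pr infB.
  have := lower p 0%N n b n p_pr (span0 p Ap) bS bN dn.
  by have := prime_gt1 p_pr; nia.
- move=> [p [p_pr infA /order1[b [bS bN]]]]; apply: ele_fin_infty => n dn.
  have [E expE] := Ptors_finite_exponent p_pr (expA p p_pr).
  have := lower p n 0%N b n p_pr _ bS bN dn; have := prime_gt1 p_pr => p_gt1.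
  have big k (g : nat -> Ptors A p) : (k < n.+1)%N ->
      exists x, forall c : nat -> int, x <> \sum_(i < k) g i *~ c i.
    by move=> _; apply: not_finite_group_span expE infA; rewrite expn_gt0 prime_gt0.
  by move=> /(_ big); nia.
move=> P [N Pbound] Pfin.
have offP p : prime p -> ~ P p -> ele (delta0 (Ptors A p) (Ptors B p)) (EFin 0).
  by move=> p_pr nP; apply: delta0_trivial => -[Ap Bp]; apply: nP.
split.
  (* Primes outside [P] contribute at most zero, so a maximum over [p <= N] bounds the supremum. *)
  have bound p : exists n, prime p -> ele (delta0 (Ptors A p) (Ptors B p)) (EFin n).
    case: (pselect (P p)) => [Pp|nP]; last by exists 0%N => p_pr; apply: offP.
    have [p_pr _ _] := Pp; have [fA fB] := Pfin p Pp.
    have [E expE] := Ptors_finite_exponent p_pr (expA p p_pr).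
    have [beta expB] := Ptors_finite_exponent p_pr fB.
    by have [n dn] := delta0_finite p_pr fA expE expB; exists n.
  have [F dF] := choice bound.
  have ub : ele (delta0 A B) (EFin (\max_(p < N.+1) F p)).
    rewrite primary; apply/esup_le => _ [p [p_pr ->]].
    case: (pselect (P p)) => [/Pbound le_p|nP]; last exact: ele_trans (offP p p_pr nP) _.
    apply: ele_trans (dF p p_pr) _.
    exact: (leq_bigmax (F := fun i : 'I_N.+1 => F i) (Ordinal (le_p : (p < N.+1)%N))).
  case E : (delta0 A B) ub => [|n|//] _; last by exists n.
  by have := @delta0_NegInf A B ntB; rewrite E; case.
move=> alpha beta dec.
have exact p : P p -> delta0 (Ptors A p) (Ptors B p) =
    EFin (\sum_(a <- alpha p) (p ^ a - 1)
          + (beta p - 1) * (p - 1) * p ^ (head 0 (alpha p) - 1))%N.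
  move=> Pp; have [p_pr Ap Bp] := Pp; have [srt pos cyc expB] := dec p Pp.
  exact: delta0_cyclic_decomposition.
apply: ele_anti.
  rewrite {1}primary; apply/esup_le => _ [p [p_pr ->]].
  case: (pselect (P p)) => [Pp|nP].
    by apply: (esupP _).1; right; exists p; rewrite exact.
  by apply: ele_trans (offP p p_pr nP) _; apply: (esupP _).1; left.
apply/esup_le => _ [->|[p [Pp ->]]].
  by have := @delta0_NegInf A B ntB; case: (delta0 A B) => //; case.
by rewrite -exact // primary; apply: (esupP _).1; exists p; case: Pp.
Qed.
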